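(* Assume that $(u:v:w)\in D_e^h$, $u>0$, $v>0$, $w>0$ and $v\ne u+w$. Then $\mathfrak{e}_{u,v,w}^h(a^2,b^2,c^2,d^2)\in\mathcal{P}_{4,6}\setminus\Sigma_{4,6}$.
   Context: $\mathcal{P}_{4,6}$ is the cone of real sextic forms in $a,b,c,d$ nonnegative on $\mathbb{R}^4$; $\Sigma_{4,6}$ is the set of finite sums of squares of real cubic forms in $a,b,c,d$. $\mathbb{R}_+=[0,\infty)$; $\mathbb{P}^2_+$ is the set of points of $\mathbb{P}^2_{\mathbb{R}}$ having nonnegative homogeneous coordinates. $\mathcal{H}_{4,3}^{c0}$ is the space of real cubic forms $f$ in $a_0,a_1,a_2,a_3$ with $f(a_1,a_2,a_3,a_0)=f(a_0,a_1,a_2,a_3)$ and $f(1,1,1,1)=0$. $\mathcal{P}_{4,3}^{c0+}$ is the cone of $f\in\mathcal{H}_{4,3}^{c0}$ with $f\ge0$ on $\mathbb{R}_+^4$. $\mathcal{E}(\mathcal{P})$ is the set of extremal elements: $0\ne f\in\mathcal{P}$ such that $f=g+h$, $g,h\in\mathcal{P}$, implies $g,h$ are multiples of $f$. With indices mod $4$, let $S_3=\sum_{i=0}^3a_i^3$, $S_{2,1,0}=\sum a_i^2a_{i+1}$, $S_{2,0,1}=\sum a_i^2a_{i+2}$, $S_{1,2,0}=\sum a_i^2a_{i+3}$, $S_{1,1,1}=\sum a_ia_{i+1}a_{i+2}$, and $s_0=S_3-S_{1,1,1}$, $s_1=S_{2,1,0}-S_{1,1,1}$, $s_2=S_{2,0,1}-S_{1,1,1}$,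 $s_3=S_{1,2,0}-S_{1,1,1}$. For $(u:v:w)\in\mathbb{P}^2_+\setminus\{(1:0:1)\}$ (representatives with nonnegative coordinates) put $$g_0^h(u,v,w)=-v\big(uwv^2-(u+w)(u^2+w^2)v+uw(u-w)^2\big),$$ $$g_1^h(u,v,w)=uv^4-w(u+2w)v^3-2uw(u-w)v^2-u(2u^3+u^2w-3w^3)v+w(u^2-w^2)^2,$$ $$g_2^h(u,v,w)=v\big(v^4+(2u^2-3uw+2w^2)v^2-(u+w)(u^2+w^2)v+(u-w)^2(u^2-uw+w^2)\big),$$ $$g_3^h(u,v,w)=g_1^h(w,v,u),\qquad \mathfrak{e}_{u,v,w}^h=\sum_{i=0}^3g_i^h(u,v,w)\,s_i ,$$ and $D_e^h=\{(u:v:w)\in\mathbb{P}^2_+:\ \mathfrak{e}_{u,v,w}^h\in\mathcal{E}(\mathcal{P}_{4,3}^{c0+})\}$. *)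

(* Defs.v *)
From mathcomp Require Import all_boot all_order all_algebra.
From mathcomp Require Import mpoly.
From mathcomp Require Import reals.

Set Implicit Arguments.
Unset Strict Implicit.
Unset Printing Implicit Defensive.

Import Order.TTheory GRing.Theory Num.Theory.

Local Open Scope ring_scope.

(* The variables a_0, ..., a_3 (also called a, b, c, d) are 'X_0, ..., 'X_3;
   their indices are added modulo 4 in the ring structure of 'I_4. *)

Section Forms.
Variable R : realType.

Definition nonneg_sextic (f : {mpoly R[4]}) : Prop :=
  f \is 6.-homog /\ forall x : 'I_4 -> R, 0 <= f.@[x].

Definition sos_cubics (f : {mpoly R[4]}) : Prop :=
  exists2 s : seq {mpoly R[4]},
    {in s, forall q, q \is 3.-homog} & f = \sum_(q <- s) q ^+ 2.

Definition cyclic_cubic0 (f : {mpoly R[4]}) : Prop :=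
  [/\ f \is 3.-homog,
      f \mPo [tuple 'X_(i + 1) | i < 4] = f
    & f.@[fun=> 1] = 0].

Definition cyclic_cubic0_pos (f : {mpoly R[4]}) : Prop :=
  cyclic_cubic0 f /\
  forall x : 'I_4 -> R, (forall i, 0 <= x i) -> 0 <= f.@[x].

Definition extremal (P : {mpoly R[4]} -> Prop) (f : {mpoly R[4]}) : Prop :=
  [/\ P f, f != 0
    & forall g h, P g -> P h -> f = g + h ->
        (exists k : R, g = k *: f) /\ (exists k : R, h = k *: f)].

Definition S3 : {mpoly R[4]} := \sum_(i < 4) 'X_i ^+ 3.
Definition S210 : {mpoly R[4]} := \sum_(i < 4) 'X_i ^+ 2 * 'X_(i + 1).
Definition S201 : {mpoly R[4]} := \sum_(i < 4) 'X_i ^+ 2 * 'X_(i + 2).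
Definition S120 : {mpoly R[4]} := \sum_(i < 4) 'X_i ^+ 2 * 'X_(i + 3).
Definition S111 : {mpoly R[4]} := \sum_(i < 4) 'X_i * 'X_(i + 1) * 'X_(i + 2).

Definition s0 := S3 - S111.
Definition s1 := S210 - S111.
Definition s2 := S201 - S111.
Definition s3 := S120 - S111.

Definition g0h (u v w : R) : R :=
  - v * (u * w * v ^+ 2 - (u + w) * (u ^+ 2 + w ^+ 2) * v
         + u * w * (u - w) ^+ 2).

Definition g1h (u v w : R) : R :=
  u * v ^+ 4 - w * (u + 2 * w) * v ^+ 3 - 2 * u * w * (u - w) * v ^+ 2
  - u * (2 * u ^+ 3 + u ^+ 2 * w - 3 * w ^+ 3) * v
  + w * (u ^+ 2 - w ^+ 2) ^+ 2.

Definition g2h (u v w : R) : R :=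
  v * (v ^+ 4 + (2 * u ^+ 2 - 3 * u * w + 2 * w ^+ 2) * v ^+ 2
       - (u + w) * (u ^+ 2 + w ^+ 2) * v
       + (u - w) ^+ 2 * (u ^+ 2 - u * w + w ^+ 2)).

Definition g3h (u v w : R) : R := g1h w v u.

Definition eh (u v w : R) : {mpoly R[4]} :=
  g0h u v w *: s0 + g1h u v w *: s1 + g2h u v w *: s2 + g3h u v w *: s3.

(* A point of the projective plane is given by homogeneous coordinates.  The
   coefficients of eh are forms of degree 5 in u, v, w, so that Deh does not
   depend on the choice of nonnegative coordinates of a point. *)
Definition in_P2_nonneg (u v w : R) : Prop :=
  [/\ 0 <= u, 0 <= v, 0 <= w & (u, v, w) <> (0, 0, 0)].

(* The last condition says (u : v : w) <> (1 : 0 : 1), where eh is not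
   defined. *)
Definition Deh (u v w : R) : Prop :=
  [/\ in_P2_nonneg u v w, ~ (v = 0 /\ u = w)
    & extremal cyclic_cubic0_pos (eh u v w)].

Definition subst_squares (f : {mpoly R[4]}) : {mpoly R[4]} :=
  f \mPo [tuple 'X_i ^+ 2 | i < 4].

End Forms.

(* Main.v *)
Require Import Defs.
From mathcomp Require Import all_boot all_order all_algebra.
From mathcomp Require Import mpoly.
From mathcomp Require Import reals.
From mathcomp Require Import ring lra.

Set Implicit Arguments.
Unset Strict Implicit.
Unset Printing Implicit Defensive.

Import Order.TTheory GRing.Theory Num.Theory.

Local Open Scope ring_scope.

(** The form f := eh u v w vanishes at (1, 1, 1, 1) and, by a polynomial
    identity together with its cyclic symmetry, at the four rotations of
    (0, u, v, w).  These are nonnegative points z, so f(a^2, b^2, c^2, d^2)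
    vanishes at every point whose coordinates are the square roots of those of
    such a z, with arbitrary signs.  If this sextic is a sum of squares of
    cubics q, then every q vanishes at all these points ([sos_zero]).

    A cubic q in four variables splits according to the parities of the
    exponents: it is the sum of the parts x_i L_i(x_0^2, ..., x_3^2), with L_i
    a linear form, and of the parts d_i (prod_(j != i) x_j)
    ([homog3_cubic_form]).  Vanishing for all choices of signs forces each
    part to vanish separately ([cubic_form_parity_parts]).  The zero
    (1, 1, 1, 1) gives d_i = 0 and L_i(1, 1, 1, 1) = 0.  Three of the rotations
    z of (0, u, v, w) have z_i != 0, hence L_i(z) = 0; the fourth rotation also
    satisfies L_i(z) = 0, because the four add up to a multiple of
    (1, 1, 1, 1).  So L_i is killed by the circulant matrix of (0, u, v, w),
    whose determinant is, up to sign,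
    (u + v + w) (u - v + w) ((u - w)^2 + v^2).  It is nonzero exactly because
    v != u + w, so L_i = 0 ([circulant_kernel]).

    Hence every q vanishes identically, and f = 0 ([eh_eq0]), but an extremal
    form is nonzero.  Nonnegativity of the sextic is the nonnegativity of f on
    the orthant. *)

Definition point (R : nmodType) (a b c d : R) (i : 'I_4) : R :=
  [:: a; b; c; d]`_i.

(** The general cubic form in four variables, with its monomials sorted by the
    parities of their exponents. *)
Definition cubic_form (R : comNzRingType) (c : 'I_4 -> 'I_4 -> R)
    (d x : 'I_4 -> R) : R :=
  \sum_i (x i * (\sum_j c i j * x j ^+ 2) + d i * \prod_(j | j != i) x j).

Lemma comp_squares_homog (R : comNzRingType) (n d : nat) (f : {mpoly R[n]}) :
  f \is d.-homog ->
  f \mPo [tuple 'X_i ^+ 2 | i < n] \is (2 * d).-homog.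
Proof.
move=> /dhomogP homf; rewrite comp_mpolyE big_seq; apply: rpred_sum => m mf.
apply: dhomogZ; have /= <- := homf m mf; rewrite mdegE big_distrr /=.
have -> : \prod_(i < n) tnth [tuple 'X_i ^+ 2 | i < n] i ^+ m i
    = 'X_[R, m *+ 2].
  rewrite -mpolyXn mpolyXE_id -prodrXl; apply: eq_bigr => i _.
  by rewrite tnth_mktuple -!exprM mulnC.
rewrite dhomogX /= mdegE; apply/eqP/eq_bigr => i _; by rewrite mulmnE mulnC.
Qed.

Lemma meval_subst_squares (R : realType) (f : {mpoly R[4]}) (x : 'I_4 -> R) :
  (subst_squares f).@[x] = f.@[fun i => x i ^+ 2].
Proof.
rewrite comp_mpoly_meval; apply: meval_eq => i.
by rewrite tnth_mktuple rmorphXn /= mevalXU.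
Qed.

Lemma meval_point_eh (R : realType) (u v w a b c d : R) :
  (eh u v w).@[point a b c d] =
    let t := a * b * c + b * c * d + c * d * a + d * a * b in
    g0h u v w * (a ^+ 3 + b ^+ 3 + c ^+ 3 + d ^+ 3 - t)
    + g1h u v w * (a ^+ 2 * b + b ^+ 2 * c + c ^+ 2 * d + d ^+ 2 * a - t)
    + g2h u v w * (a ^+ 2 * c + b ^+ 2 * d + c ^+ 2 * a + d ^+ 2 * b - t)
    + g3h u v w * (a ^+ 2 * d + b ^+ 2 * a + c ^+ 2 * b + d ^+ 2 * c - t).
Proof.
rewrite /eh /s0 /s1 /s2 /s3 /S3 /S210 /S201 /S120 /S111.
rewrite !big_ord_recl !big_ord0 /=.
rewrite !(mevalD, mevalN, mevalZ, mevalM, rmorphXn) /= !mevalXU ?meval0.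
rewrite /point /=.
ring.
Qed.

Lemma ord4_ind (P : 'I_4 -> Prop) :
  P ord0 -> P (lift ord0 ord0) -> P (lift ord0 (lift ord0 ord0)) ->
  P (lift ord0 (lift ord0 (lift ord0 ord0))) -> forall i, P i.
Proof.
move=> P0 P1 P2 P3 i; do 3! (case: (unliftP ord0 i) => [{}i|] -> //).
by rewrite (ord1 i).
Qed.

(** Any exponent vector of degree 3 is either [U_(i) + 2 U_(j)], odd at i only,
    or the indicator of the complement of some i. *)
Lemma homog3_cubic_form (R : comNzRingType) (q : {mpoly R[4]}) :
  q \is 3.-homog -> exists c d, forall x, q.@[x] = cubic_form c d x.
Proof.
move=> /dhomogP homq; rewrite [q]mpolyE big_seq.
pose rep (p : {mpoly R[4]}) := exists c d, forall x, p.@[x] = cubic_form c d x.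
apply: (big_ind rep) => [|p1 p2 [c1 [d1 E1]] [c2 [d2 E2]]|m mq].
- exists (fun _ _ => 0), (fun _ => 0) => x; rewrite meval0 /cubic_form big1 // => i _.
  by rewrite big1 ?mulr0 ?mul0r ?addr0 // => j _; rewrite mul0r.
- exists (fun i j => c1 i j + c2 i j), (fun i => d1 i + d2 i) => x.
  rewrite mevalD E1 E2 -big_split; apply: eq_bigr => i _ /=.
  under [in RHS]eq_bigr do rewrite mulrDl.
  by rewrite big_split /=; ring.
exists (fun i j => q@_m * [forall k, m k == (i == k) + 2 * (j == k)]%N%:R).
exists (fun i => q@_m * [forall k, m k == (k != i)]%N%:R) => x.
rewrite mevalZ mevalX.
have := homq m mq; rewrite /= mdegE.
have forallI4 (P : pred 'I_4) : [forall k, P k] =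
    [&& P ord0, P (lift ord0 ord0),
    P (lift ord0 (lift ord0 ord0)) & P (lift ord0 (lift ord0 (lift ord0 ord0)))].
  apply/forallP/and4P => [allP|[P0 P1 P2 P3] k]; first by split.
  by elim/ord4_ind: k.
rewrite /cubic_form !big_ord_recl !big_ord0 !forallI4 !muln0 !muln1 /=.
have prodC1 i : \prod_(j | j != i) x j = \prod_j (if j != i then x j else 1).
  exact: big_mkcond.
rewrite !prodC1 !big_ord_recl !big_ord0 /=.
move: (q@_m) (x _) (x _) (x _) (x _) => k a b c d.
(* In the case analysis on the four exponents, the indicators turn into
   numbers, and exactly one coefficient survives. *)
case: (m ord0) => [|[|[|[|?]]]]; case: (m (lift ord0 ord0)) => [|[|[|[|?]]]];
  case: (m (lift ord0 (lift ord0 ord0))) => [|[|[|[|?]]]] //=;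
  case: (m _) => [|[|[|[|?]]]] //= _; ring.
Qed.

(** Since e_i^2 = 1, the product of the e_j with j != i is e_i times the product
    of all of them, so each part is multiplied by a character of the group of
    sign changes. *)
Lemma cubic_form_sign (R : comNzRingType) (c : 'I_4 -> 'I_4 -> R)
    (d e x : 'I_4 -> R) :
  (forall i, e i ^+ 2 = 1) ->
  cubic_form c d (fun i => e i * x i) =
    \sum_i e i * (x i * (\sum_j c i j * x j ^+ 2)
                  + (\prod_j e j) * (d i * \prod_(j | j != i) x j)).
Proof.
move=> e2; apply: eq_bigr => i _; rewrite big_split /= [\prod_j e j](bigD1 i) //=.
under eq_bigr do rewrite exprMn e2 mul1r.
move: (\prod_(j | _) _) (\prod_(j | _) x j) => p y.
by rewrite -[d i * (p * y)]mul1r -(e2 i); ring.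
Qed.

(** The eight parts are multiplied by eight characters of the sign changes that
    stay distinct when e_0 = 1; inverting this character table recovers each
    part from the eight signed values. *)
Lemma cubic_form_parity_parts (R : realFieldType) (c : 'I_4 -> 'I_4 -> R)
    (d x : 'I_4 -> R) :
  (forall e : 'I_4 -> R, (forall i, e i ^+ 2 = 1) ->
     cubic_form c d (fun i => e i * x i) = 0) ->
  forall i, x i * (\sum_j c i j * x j ^+ 2) = 0
         /\ d i * \prod_(j | j != i) x j = 0.
Proof.
move=> zero.
pose A i := x i * (\sum_j c i j * x j ^+ 2).
pose D i := d i * \prod_(j | j != i) x j.
have signed (e1 e2 e3 : bool) :
    let e := point 1 ((-1) ^+ e1) ((-1) ^+ e2) ((-1) ^+ e3) in
    \sum_i e i * (A i + (\prod_j e j) * D i) = 0.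
  move=> e; have sqr_e i : e i ^+ 2 = 1.
    by elim/ord4_ind: i; rewrite /e /point /= ?expr1n ?sqrr_sign.
  by rewrite -cubic_form_sign ?zero.
move: (signed false false false) (signed false false true)
  (signed false true false) (signed false true true)
  (signed true false false) (signed true false true)
  (signed true true false) (signed true true true).
rewrite /= !big_ord_recl !big_ord0 /point /=.
move=> E1 E2 E3 E4 E5 E6 E7 E8.
by elim/ord4_ind; rewrite -/(A _) -/(D _); split; lra.
Qed.

Lemma point_gt0 (R : realFieldType) (u v w : R) (i : 'I_4) :
  0 < u -> 0 < v -> 0 < w -> i != 0 -> 0 < point 0 u v w i.
Proof. by move=> u0 v0 w0; elim/ord4_ind: i. Qed.

(** In the Fourier basis of the cyclic group of order 4, the component of c
    along the trivial character is the sum of c, and the component along the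
    alternating character is multiplied by u - v + w, up to sign.  On the real
    plane of the two other components, with coordinates c0 - c2 and c1 - c3,
    the circulant matrix has determinant (u - w)^2 + v^2. *)
Lemma circulant_kernel (R : realFieldType) (u v w : R) (c : 'I_4 -> R) :
  0 < v -> v != u + w -> \sum_j c j = 0 ->
  (forall k, \sum_j c j * point 0 u v w (j + k) = 0) -> forall j, c j = 0.
Proof.
move=> v0 vuw sumc E.
move: sumc (E ord0) (E (lift ord0 ord0)) (E (lift ord0 (lift ord0 ord0)))
  (E (lift ord0 (lift ord0 (lift ord0 ord0)))).
rewrite !big_ord_recl !big_ord0 /point /= !(mulr0, addr0, add0r).
move: (c ord0) (c (lift ord0 ord0)) (c (lift ord0 (lift ord0 ord0)))
  (c (lift ord0 (lift ord0 (lift ord0 ord0))))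
  (@ord4_ind (fun j => c j = 0)) => c0 c1 c2 c3 conclude sumc E0 E1 E2 E3.
have p_eq : (u - w) * (c0 - c2) + v * (c1 - c3) = 0.
  by rewrite -[RHS]subr0 -{1}E1 -E3; ring.
have q_eq : (u - w) * (c1 - c3) - v * (c0 - c2) = 0.
  by rewrite -[RHS]subr0 -{1}E0 -E2; ring.
have dpos : 0 < (u - w) ^+ 2 + v ^+ 2.
  by rewrite ltr_wpDl ?sqr_ge0 ?exprn_gt0.
have p0 : c0 - c2 = 0.
  apply: (mulfI (lt0r_neq0 dpos)); rewrite mulr0.
  transitivity ((u - w) * 0 - v * 0 : R); last by rewrite !mulr0 subr0.
  by rewrite -{1}p_eq -q_eq; ring.
have q0 : c1 - c3 = 0.
  apply: (mulfI (lt0r_neq0 dpos)); rewrite mulr0.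
  transitivity (v * 0 + (u - w) * 0 : R); last by rewrite !mulr0 addr0.
  by rewrite -{1}p_eq -q_eq; ring.
have c10 : c1 = - c0 by lra.
have c00 : c0 = 0.
  have uwv : u + w - v != 0 by rewrite subr_eq0 eq_sym.
  apply: (mulfI uwv); rewrite mulr0 -E1 c10.
  have -> : c2 = c0 by lra.
  ring.
apply: conclude; lra.
Qed.

Lemma meval_rotation (R : comNzRingType) (f : {mpoly R[4]}) (z : 'I_4 -> R)
    (k : 'I_4) :
  f \mPo [tuple 'X_(i + 1) | i < 4] = f ->
  f.@[fun j => z (j + k)] = f.@[z].
Proof.
move=> cyc; rewrite -[k]natr_Zp; elim: (val k) => [|n IHn].
  by apply: meval_eq => j; rewrite addr0.
rewrite -IHn -[in RHS]cyc comp_mpoly_meval; apply: meval_eq => j.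
by rewrite tnth_mktuple mevalXU mulrS addrA.
Qed.

Lemma sos_zero (R : realFieldType) (f : {mpoly R[4]}) (s : seq {mpoly R[4]})
    (x : 'I_4 -> R) :
  f = \sum_(q <- s) q ^+ 2 -> f.@[x] = 0 -> {in s, forall q, q.@[x] = 0}.
Proof.
move=> ->; rewrite rmorph_sum /= => /eqP.
rewrite psumr_eq0 => [/allP /= zero q qs|q _]; last by rewrite rmorphXn sqr_ge0.
by have := zero q qs; rewrite rmorphXn sqrf_eq0 => /eqP.
Qed.

(** The coefficients of [eh] are determined by its values at (1, 0, 0, 0),
    (1, 1, 0, 0), (1, 4, 0, 0) and (1, 0, 1, 0), whose coordinates are
    squares. *)
Lemma eh_eq0 (R : realType) (u v w : R) :
  (forall x, (subst_squares (eh u v w)).@[x] = 0) -> eh u v w = 0.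
Proof.
move=> zero.
have sq a b c d : (eh u v w).@[point (a ^+ 2) (b ^+ 2) (c ^+ 2) (d ^+ 2)] = 0.
  rewrite -(zero (point a b c d)) meval_subst_squares; apply: meval_eq.
  by elim/ord4_ind.
have := (sq 1 0 0 0, sq 1 1 0 0, sq 1 2 0 0, sq 1 0 1 0).
rewrite !meval_point_eh /= => -[[[e0 e1] e2] e3].
have [g0 g1 g2 g3] : [/\ g0h u v w = 0, g1h u v w = 0, g2h u v w = 0
    & g3h u v w = 0].
  by split; lra.
by rewrite /eh g0 g1 g2 g3 !scale0r !addr0.
Qed.

(** A zero z of f in the nonnegative orthant gives the zeros
    (+- sqrt z_0, ..., +- sqrt z_3) of the sextic, hence of q; the first
    conclusion is the vanishing of the part odd in x_i at one of them,
    multiplied by sqrt z_i to clear the square root. *)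
Lemma sos_parity_parts (R : realType) (f : {mpoly R[4]}) (s : seq {mpoly R[4]})
    (c : 'I_4 -> 'I_4 -> R) (d z : 'I_4 -> R) (q : {mpoly R[4]}) :
  subst_squares f = \sum_(q <- s) q ^+ 2 -> q \in s ->
  (forall x, q.@[x] = cubic_form c d x) ->
  (forall i, 0 <= z i) -> f.@[z] = 0 ->
  forall i, z i * (\sum_j c i j * z j) = 0
         /\ d i * \prod_(j | j != i) Num.sqrt (z j) = 0.
Proof.
move=> sos qs qE z_ge0 fz i.
have [e e1|] := @cubic_form_parity_parts R c d (fun i => Num.sqrt (z i)) _ i.
  rewrite -qE; apply: (sos_zero sos) => //.
  rewrite meval_subst_squares -[RHS]fz; apply: meval_eq => j.
  by rewrite exprMn e1 mul1r sqr_sqrtr.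
under [\sum_j _]eq_bigr do rewrite sqr_sqrtr //.
move=> /eqP; rewrite mulf_eq0 => vanish ->; split=> //.
case/orP: vanish => [|/eqP ->]; last by rewrite mulr0.
rewrite sqrtr_eq0 => zi; suff -> : z i = 0 by rewrite mul0r.
by apply: le_anti; rewrite zi z_ge0.
Qed.

Theorem proposition1p11 (R : realType) (u v w : R) :
  Deh u v w -> 0 < u -> 0 < v -> 0 < w -> v <> u + w ->
  nonneg_sextic (subst_squares (eh u v w)) /\
  ~ sos_cubics (subst_squares (eh u v w)).
Proof.
move=> [_ _ [[[homf cycf f1] posf] f_neq0 _]] u0 v0 w0 /eqP vuw; split.
  split=> [|x]; first exact: (@comp_squares_homog R 4 3).
  by rewrite meval_subst_squares posf // => i; rewrite sqr_ge0.
move=> [s hom_s sos]; case/eqP: f_neq0; apply: eh_eq0 => x.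
rewrite sos rmorph_sum big_seq big1 //= => q qs; rewrite rmorphXn /=.
have [c [d qE]] := homog3_cubic_form (hom_s q qs).
suff [c0 d0] : (forall i j, c i j = 0) /\ (forall i, d i = 0).
  rewrite qE /cubic_form big1 ?expr0n // => i _; rewrite d0 mul0r addr0.
  by rewrite big1 ?mulr0 // => j _; rewrite c0 mul0r.
have parts z := sos_parity_parts (z := z) sos qs qE.
have [sumc d0] : (forall i, \sum_j c i j = 0) /\ (forall i, d i = 0).
  suff H i : \sum_j c i j = 0 /\ d i = 0 by split=> i; have [] := H i.
  have [|] := parts (fun=> 1) _ f1 i; first by move=> ?; apply: ler01.
  rewrite mul1r sqrtr1 big1_eq mulr1 => sum_c d_i; split=> //.
  by rewrite -[RHS]sum_c; apply: eq_bigr => j _; rewrite mulr1.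
split=> // i; pose z := point 0 u v w.
have z_gt0 (j : 'I_4) : j != 0 -> 0 < z j by apply: point_gt0.
have z_ge0 (j : 'I_4) : 0 <= z j.
  by have [->|/z_gt0/ltW//] := eqVneq j 0; rewrite /z /point.
have fz k : (eh u v w).@[fun j => z (j + k)] = 0.
  rewrite (meval_rotation _ k cycf) meval_point_eh /g3h /g0h /g1h /g2h /=; ring.
have nonzero_coord k : i + k != 0 -> \sum_j c i j * z (j + k) = 0.
  move=> ik; have [] := parts _ _ (fz k) i; first by [].
  by move=> /eqP; rewrite mulf_eq0 gt_eqF ?z_gt0 //= => /eqP.
apply: circulant_kernel v0 vuw (sumc i) _ => k.
(* The remaining rotation, the one whose i-th coordinate is 0. *)
have [|/nonzero_coord//] := eqVneq (i + k) 0 => /eqP.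
rewrite addr_eq0 => /eqP ik.
have total : \sum_l \sum_j c i j * z (j + l) = 0.
  have shift j : \sum_l z (j + l) = \sum_l z l.
    by rewrite [RHS](reindex_inj (addrI j)).
  rewrite exchange_big /=; under eq_bigr do rewrite -mulr_sumr shift.
  by rewrite -mulr_suml sumc mul0r.
move: total; rewrite (bigD1 k) //= [X in _ + X]big1 ?addr0 // => l lk.
by apply: nonzero_coord; rewrite addr_eq0 ik eqr_opp eq_sym.
Qed.
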